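(* The algebra $\mathcal H$ is free as an $A$-module with basis $\{t_x\mid x\in WH_b\}$.
   Context: Let $q$ be a prime power, $n\ge1$, and $a,b$ relatively prime positive integers with $ab=q-1$. Let $F_b$ be the subgroup of order $b$ of $\mathbb F_q^\times$, $H_b$ the group of diagonal matrices in $\mathrm{GL}_n(\mathbb F_q)$ with entries in $F_b$, and $W\subset\mathrm{GL}_n(\mathbb F_q)$ the group of permutation matrices, so $WH_b$ is a subgroup isomorphic to $G(b,1,n)$. Let $\mathcal S=\{s_1,\dots,s_{n-1}\}$, where $s_i$ is the permutation matrix of the transposition $(i,i+1)$, and let $\ell$ be the length function of the Coxeter group $(W,\mathcal S)$. For $\alpha\in F_b$, $h_i(\alpha)$ is the diagonal matrix with $i$-th diagonal entry $\alpha$ and other diagonal entries $1$; $h_{i,j}(\alpha)=h_i(\alpha)h_j((-1)^{b-1}\alpha^{-1})$ for $i\ne j$; and $X_{s_i}=\{h_{i,i+1}(\alpha)\mid\alpha\in F_b\}$. Let $A=\mathbb Z[\mathbf a,\mathbf v]$ with $\mathbf a,\mathbf v$ indeterminates and set $\mathbf q=\mathbf v^2$. $\mathcal H$ is the $A$-algebra, with identity $1_{\mathcal H}$, given by generators $\{t_s\mid s\in\mathcal S\}\cup\{t_d\mid d\in H_b\}$ and relations: $t_dt_{d'}=t_{dd'}$; $t_dt_{s_i}=t_{s_i}t_{s_ids_i}$; $t_{s_i}t_{s_j}=t_{s_j}t_{s_i}$ if $|j-i|>1$; $t_{s_i}t_{s_{i+1}}t_{s_i}=t_{s_{i+1}}t_{s_i}t_{s_{i+1}}$;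 $t_{s_i}^2=\mathbf q1_{\mathcal H}+\mathbf a\sum_{d\in X_{s_i}}t_dt_{s_i}$ (for all $d,d'\in H_b$ and all indices $i,j$ in $\{1,\dots,n-1\}$ for which the relation makes sense). For $w\in W$ with $w=s_{i_1}\cdots s_{i_p}$ and $\ell(w)=p$, set $t_w=t_{s_{i_1}}\cdots t_{s_{i_p}}$ (by Matsumoto's theorem this depends only on $w$). For $w\in W$ and $d\in H_b$ set $t_{wd}=t_wt_d$ and $t_{dw}=t_dt_w$; in this way an element $t_x$ is attached to every $x\in WH_b$.
   Formalization: The relation t_1 = 1_H (generator t_d at d = 1 equals the identity) is added to the listed relations: without it t_1 is only a central idempotent, t_x at x = 1 is doubly defined, and the claim fails (n = b = 1 gives rank 2). *)

(* Defs.v *)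
From HB Require Import structures.
From mathcomp Require Import all_boot all_order all_algebra all_fingroup pgroup.
From mathcomp Require Import generic_quotient ring_quotient.
From mathcomp Require Import boolp zify.
From mathcomp Require Import monalg mpoly.

Set Implicit Arguments.
Unset Strict Implicit.
Unset Printing Implicit Defensive.

Import GRing.Theory.

Section Matsumoto.

Variable m : nat.

Definition adj_lo (i : 'I_m) : 'I_m.+1 := widen_ord (leqnSn m) i.
Definition adj_hi (i : 'I_m) : 'I_m.+1 := lift ord0 i.
Definition adj_tperm (i : 'I_m) : 'S_m.+1 := tperm (adj_lo i) (adj_hi i).

Lemma adj_lt i : adj_lo i < adj_hi i. Proof. by rewrite /= /bump. Qed.

Local Open Scope group_scope.

Definition perm_word (w : seq 'I_m) : 'S_m.+1 := \prod_(i <- w) adj_tperm i.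

Definition inversions (s : 'S_m.+1) : {set 'I_m.+1 * 'I_m.+1} :=
  [set p : 'I_m.+1 * 'I_m.+1 | (p.1 < p.2) && (s p.2 < s p.1)].

Lemma adj_tperm_val i (k : 'I_m.+1) :
  adj_tperm i k = (if k == i :> nat then i.+1
   else if k == i.+1 :> nat then i : nat else k) :> nat.
Proof.
rewrite /adj_tperm; case: tpermP => [->|->|/eqP nlo /eqP nhi] /=.
- by rewrite eqxx.
- by rewrite /bump leq0n add1n eqxx gtn_eqF.
- move: nlo nhi; rewrite -!val_eqE /= /bump leq0n add1n.
  by move=> /negPf-> /negPf->.
Qed.

Lemma inversions_asc i (s : 'S_m.+1) : s (adj_lo i) < s (adj_hi i) ->
  #|inversions (adj_tperm i * s)| = #|inversions s|.+1.
Proof.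
move=> asc; pose g (p : 'I_m.+1 * 'I_m.+1) := (adj_tperm i p.1, adj_tperm i p.2).
have gK : involutive g by case=> a b; rewrite /g /= /adj_tperm !tpermK.
have gE (D : {set 'I_m.+1 * 'I_m.+1}) p : (p \in g @: D) = (g p \in D).
  apply/imsetP/idP => [[q qD ->]|gpD]; first by rewrite gK.
  by exists (g p) => //; rewrite gK.
have nin : (adj_lo i, adj_hi i) \notin g @: inversions s.
  by rewrite gE inE /g /= /adj_tperm tpermL tpermR ltnNge (ltnW (adj_lt i)).
have -> : inversions (adj_tperm i * s) =
    (adj_lo i, adj_hi i) |: g @: inversions s.
  apply/setP => -[a b]; rewrite in_setU1 gE !inE /= !permM xpair_eqE.
  have [/andP[/eqP-> /eqP->]|] := boolP ((a == adj_lo i) && (b == adj_hi i)).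
    by rewrite /adj_tperm tpermL tpermR asc adj_lt.
  move=> nab /=.
  have [/andP[/eqP-> /eqP->]|nba] := boolP ((a == adj_hi i) && (b == adj_lo i)).
    by rewrite /adj_tperm tpermL tpermR (ltnNge (s _) (s _)) (ltnW asc) !andbF.
  congr (_ && _); rewrite !adj_tperm_val.
  move: nab nba; rewrite -!val_eqE /= /bump leq0n add1n.
  move: (a : nat) (b : nat) (i : nat) => a' b' i'.
  by repeat case: eqP; lia.
by rewrite cardsU1 nin card_imset //; exact: can_inj gK.
Qed.

Lemma adj_tpermL i : adj_tperm i (adj_lo i) = adj_hi i.
Proof. exact: tpermL. Qed.

Lemma adj_tpermR i : adj_tperm i (adj_hi i) = adj_lo i.
Proof. exact: tpermR. Qed.

Lemma adj_tpermK i : involutive (mulg (adj_tperm i)).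
Proof. by move=> s; rewrite mulgA tperm2 mul1g. Qed.

Lemma inversions_desc i (s : 'S_m.+1) : s (adj_hi i) < s (adj_lo i) ->
  #|inversions s| = #|inversions (adj_tperm i * s)|.+1.
Proof.
move=> desc; rewrite -{1}(adj_tpermK i s) inversions_asc //.
by rewrite !permM /adj_tperm tpermL tpermR.
Qed.

Lemma adj_asc_or_desc i (s : 'S_m.+1) :
  (s (adj_lo i) < s (adj_hi i)) || (s (adj_hi i) < s (adj_lo i)).
Proof.
by rewrite -neq_ltn val_eqE (inj_eq perm_inj) -val_eqE ltn_eqF ?adj_lt.
Qed.

Lemma inversions1 : #|inversions 1| = 0.
Proof.
apply/eqP; rewrite cards_eq0; apply/eqP/setP => -[a b].
by rewrite !inE !perm1 /=; case: ltngtP.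
Qed.

Lemma perm_no_desc (s : 'S_m.+1) :
  (forall i, s (adj_lo i) < s (adj_hi i)) -> s = 1.
Proof.
move=> asc; have le_s (k : nat) (km : k < m.+1) : k <= s (Ordinal km).
  elim: k km => // k IHk km; apply: leq_ltn_trans (IHk (ltnW km)) _.
  have := asc (Ordinal (km : k < m)); congr (_ < _); congr (val (s _));
    by apply: val_inj; rewrite /= ?/bump.
have le_s' (k : 'I_m.+1) : true -> val k <= s k ?= iff (val k == s k).
  by move=> _; case: k => k km; split=> //; exact: le_s.
have [_] := leqif_sum le_s'.
rewrite [X in _ == X](reindex_inj (h := s^-1)) /=; last exact: perm_inj.
under [X in _ == X]eq_bigr do rewrite permKV.
rewrite eqxx => /esym/forallP sE; apply/permP => k; rewrite perm1.
by apply: val_inj; apply/esym/eqP/sE.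
Qed.

Lemma perm_word_cons i w : perm_word (i :: w) = adj_tperm i * perm_word w.
Proof. by rewrite /perm_word big_cons. Qed.

Lemma inversions_perm_word w : #|inversions (perm_word w)| <= size w.
Proof.
elim: w => [|i w IHw]; first by rewrite /perm_word big_nil inversions1.
rewrite perm_word_cons /=; have /orP[/inversions_asc->//|] :=
  adj_asc_or_desc i (perm_word w).
by move=> /inversions_desc E; apply: leq_trans (leq_trans IHw (leqnSn _)); rewrite E.
Qed.

Lemma perm_word_exists (s : 'S_m.+1) :
  exists2 w, perm_word w = s & size w = #|inversions s|.
Proof.
move: {2}#|_| (erefl #|inversions s|) => k.
elim: k s => [|k IHk] s Ek.
  exists [::] => //; rewrite /perm_word big_nil; apply/esym/perm_no_desc => i.
  by have /orP[//|/inversions_desc] := adj_asc_or_desc i s; rewrite Ek.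
have [/forallP asc|] := boolP [forall i, s (adj_lo i) < s (adj_hi i)].
  by move: Ek; rewrite (perm_no_desc asc) inversions1.
rewrite negb_forall => /existsP[i]; have := adj_asc_or_desc i s.
case: (_ < _) => //= desc _; have := inversions_desc desc.
rewrite Ek => -[Ek']; have [w wE sz] := IHk _ (esym Ek').
exists (i :: w); first by rewrite perm_word_cons wE adj_tpermK.
by rewrite /= sz -Ek'.
Qed.

Local Open Scope ring_scope.


Lemma reduced_cons i w :
    size (i :: w) = #|inversions (perm_word (i :: w))| ->
  (perm_word (i :: w) (adj_hi i) < perm_word (i :: w) (adj_lo i))%N /\
  size w = #|inversions (perm_word w)|.
Proof.
rewrite perm_word_cons /= => sz; have := inversions_perm_word w.
have /orP[asc|desc] := adj_asc_or_desc i (perm_word w).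
  have := inversions_asc asc; rewrite -sz => -[<-] _.
  by rewrite !permM /adj_tperm tpermL tpermR.
by have := inversions_desc desc; rewrite -sz => ->; rewrite ltnNge leqnSn.
Qed.

Lemma adj_tperm_comm (i j : 'I_m) : (i.+1 < j)%N ->
  (adj_tperm i * adj_tperm j = adj_tperm j * adj_tperm i)%g.
Proof.
move=> ij; apply/permP => k; rewrite !permM; apply: val_inj.
by rewrite /= !adj_tperm_val; do !case: eqP; lia.
Qed.

Lemma adj_tperm_braid (i j : 'I_m) : j = i.+1 :> nat ->
  (adj_tperm i * adj_tperm j * adj_tperm i =
   adj_tperm j * adj_tperm i * adj_tperm j)%g.
Proof.
move=> ij; apply/permP => k; rewrite !permM; apply: val_inj.
by rewrite /= !adj_tperm_val; do !case: eqP; lia.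
Qed.

Lemma perm_word_matsumoto (R : pzRingType) (t : 'I_m -> R) :
    (forall i j : 'I_m, (i.+1 < j)%N -> t i * t j = t j * t i) ->
    (forall i j : 'I_m, j = i.+1 :> nat -> t i * t j * t i = t j * t i * t j) ->
  forall u v, perm_word u = perm_word v ->
    size u = #|inversions (perm_word u)| -> size v = #|inversions (perm_word v)| ->
  \prod_(i <- u) t i = \prod_(i <- v) t i.
Proof.
move=> comm braid u.
move: {2}(size u) (erefl (size u)) => k; elim/ltn_ind: k u => k IH u uk v uv ur vr.
have vk : size v = k by rewrite vr -uv -ur.
have step w1 w2 : (size w1 < k)%N -> perm_word w1 = perm_word w2 ->
    size w1 = #|inversions (perm_word w1)| -> size w2 = size w1 ->
    \prod_(i <- w1) t i = \prod_(i <- w2) t i.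
  by move=> lt E r1 r2; apply: (IH _ lt) => //; rewrite r2 r1 E.
suff main (i j : 'I_m) u' v' : (i < j)%N -> size (i :: u') = k -> size (j :: v') = k ->
    perm_word (i :: u') = perm_word (j :: v') ->
    size (i :: u') = #|inversions (perm_word (i :: u'))| ->
    size (j :: v') = #|inversions (perm_word (j :: v'))| ->
    \prod_(h <- i :: u') t h = \prod_(h <- j :: v') t h.
  case: u uk uv ur => [|i u] uk uv ur.
    by case: v vk {uv vr} => //; rewrite -uk.
  case: v vk uv vr => [|j v] vk uv vr; first by rewrite -uk in vk.
  have [ij|ji|/val_inj ij] := ltngtP i j; first exact: main.
    by apply/esym/main.
  subst j; rewrite !big_cons; congr (_ * _); have [_ ur'] := reduced_cons ur.
  apply: step => //; first by rewrite -uk.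
    by move: uv; rewrite !perm_word_cons => /mulgI.
  by apply: succn_inj; rewrite -[LHS]/(size (i :: v)) vk -uk.
move=> ij {}uk {}vk {}uv {}ur {}vr.
have [idesc ur'] := reduced_cons ur; have [jdesc vr'] := reduced_cons vr.
rewrite -uv in jdesc.
set s := perm_word (i :: u') in uv idesc jdesc.
have uE : perm_word u' = (adj_tperm i * s)%g by rewrite /s perm_word_cons adj_tpermK.
have vE : perm_word v' = (adj_tperm j * s)%g
  by rewrite uv perm_word_cons adj_tpermK.
rewrite !big_cons.
have szv : size v' = size u' by apply: succn_inj; rewrite -[LHS]/(size (j :: v')) vk -uk.
have ltk : (size u' < k)%N by rewrite -uk.
have [ij2|] := boolP (i.+1 < j)%N.
  pose x := (adj_tperm j * (adj_tperm i * s))%g.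
  have xd : ((adj_tperm i * s)%g (adj_hi j) < (adj_tperm i * s)%g (adj_lo j))%N.
    rewrite !permM.
    have -> : adj_tperm i (adj_hi j) = adj_hi j.
      by apply: val_inj; rewrite /= adj_tperm_val /= /bump; do !case: eqP; lia.
    have -> : adj_tperm i (adj_lo j) = adj_lo j.
      by apply: val_inj; rewrite /= adj_tperm_val /=; do !case: eqP; lia.
    by [].
  have [z zE zsz] := perm_word_exists x.
  have szu : size u' = (size z).+1 by rewrite ur' uE zsz (inversions_desc xd).
  rewrite (step u' (j :: z)) ?(step v' (i :: z)) //.
  - by rewrite !big_cons !mulrA comm.
  - by rewrite szv.
  - rewrite vE perm_word_cons zE /x !mulgA; congr (_ * _)%g.
    by rewrite adj_tperm_comm // -mulgA tperm2 mulg1.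
  - by rewrite szv.
  - by rewrite uE perm_word_cons zE /x adj_tpermK.
rewrite -leqNgt => ji; have {}ji : j = i.+1 :> nat by apply/eqP; rewrite eqn_leq ji ij.
have hilo : adj_hi i = adj_lo j by apply: val_inj; rewrite /= ji.
pose x1 := (adj_tperm j * (adj_tperm i * s))%g.
have x1d : ((adj_tperm i * s)%g (adj_hi j) < (adj_tperm i * s)%g (adj_lo j))%N.
  rewrite !permM -hilo adj_tpermR.
  have -> : adj_tperm i (adj_hi j) = adj_hi j.
    by apply: val_inj; rewrite /= adj_tperm_val /= /bump; do !case: eqP; lia.
  by apply: ltn_trans jdesc _; rewrite -hilo.
pose x2 := (adj_tperm i * x1)%g.
have x2d : (x1 (adj_hi i) < x1 (adj_lo i))%N.
  rewrite /x1 !permM hilo adj_tpermL.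
  have -> : adj_tperm j (adj_lo i) = adj_lo i.
    by apply: val_inj; rewrite /= adj_tperm_val /=; do !case: eqP; lia.
  have -> : adj_tperm i (adj_hi j) = adj_hi j.
    by apply: val_inj; rewrite /= adj_tperm_val /= /bump; do !case: eqP; lia.
  by rewrite adj_tpermL hilo.
have [z zE zsz] := perm_word_exists x2.
have szu : size u' = (size z).+2.
  by rewrite ur' uE zsz (inversions_desc x1d) (inversions_desc x2d).
rewrite (step u' [:: j, i & z]) ?(step v' [:: i, j & z]) //.
- by rewrite !big_cons !mulrA braid.
- by rewrite szv.
- rewrite vE !perm_word_cons zE /x2 /x1 !mulgA; congr (_ * s)%g.
  rewrite adj_tperm_braid // -(mulgA _ (adj_tperm j) (adj_tperm j)).
  by rewrite tperm2 mulg1 -mulgA tperm2 mulg1.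
- by rewrite szv.
- by rewrite uE !perm_word_cons zE /x2 /x1 !adj_tpermK.
Qed.
End Matsumoto.

Local Open Scope ring_scope.
Local Open Scope quotient_scope.

Section PresentedAlgebra.

Variables (R : comNzRingType) (I : choiceType).

(* Noncommutative polynomials: the monoid algebra of the free monoid on I. *)
Definition free_alg := {malg R[{fmonom I}]}.
HB.instance Definition _ := GRing.Lalgebra.on free_alg.

(* The uses of [locked] here and below keep unification from unfolding the
   constructions when it compares two distinct products. *)
Definition free_gen : I -> free_alg := locked (fun i => << fmu i >>).

Lemma free_alg_scalerAr (c : R) (x y : free_alg) : c *: (x * y) = x * (c *: y).
Proof.
pose C : free_alg := << c *g monalg.one >>.
have CE (z : free_alg) : c *: z = C * z by rewrite -mul_malgC.
have CC (z : free_alg) : C * z = z * C.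
  rewrite !malgM_def fgmulUg fgmulgU; apply: eq_bigr => k _.
  by rewrite monalg.mul1m monalg.mulm1 mulrC.
by rewrite !CE mulrA CC mulrA.
Qed.
HB.instance Definition _ := GRing.Lalgebra_isAlgebra.Build R free_alg
  free_alg_scalerAr.

Variable rel : free_alg -> free_alg -> Prop.

(* The two-sided ideal generated by the elements x - y with rel x y. *)
Inductive rel_ideal : free_alg -> Prop :=
| rel_ideal_gen x y : rel x y -> rel_ideal (x - y)
| rel_ideal0 : rel_ideal 0
| rel_idealB x y : rel_ideal x -> rel_ideal y -> rel_ideal (x - y)
| rel_idealMl z x : rel_ideal x -> rel_ideal (z * x)
| rel_idealMr z x : rel_ideal x -> rel_ideal (x * z).

Definition rel_ideal_pred (x : free_alg) : bool := `[< rel_ideal x >].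

Lemma rel_ideal_zmod_closed : zmod_closed rel_ideal_pred.
Proof.
split; first by apply/asboolP; exact: rel_ideal0.
by move=> x y /asboolP xI /asboolP yI; apply/asboolP; exact: rel_idealB.
Qed.
HB.instance Definition _ := GRing.isZmodClosed.Build free_alg rel_ideal_pred
  rel_ideal_zmod_closed.

(* The R-algebra with generators I and relations x = y for rel x y. *)
Definition pres_alg :=
  {ideal_quot GRing.ZmodClosed.clone free_alg rel_ideal_pred _}.
HB.instance Definition _ := GRing.Zmodule.on pres_alg.
HB.instance Definition _ := EqQuotient.on pres_alg.

Definition pres_proj (x : free_alg) : pres_alg := \pi_pres_alg x.

Lemma pres_proj_surj (u : pres_alg) : exists x, u = pres_proj x.
Proof. by exists (repr u); rewrite /pres_proj reprK. Qed.

Lemma pres_projP (x y : free_alg) :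
  pres_proj x = pres_proj y <-> rel_ideal (x - y).
Proof.
split; first by move/eqP; rewrite -Quotient.idealrBE => /asboolP.
by move=> xyI; apply/eqP; rewrite -Quotient.idealrBE; apply/asboolP.
Qed.

Lemma pres_projB : {morph pres_proj : x y / x - y}.
Proof. by move=> x y; rewrite /pres_proj !piE. Qed.

Lemma pres_projD : {morph pres_proj : x y / x + y}.
Proof. by move=> x y; rewrite /pres_proj !piE. Qed.

Definition pres_one : pres_alg := pres_proj 1.
Definition pres_mul : pres_alg -> pres_alg -> pres_alg :=
  locked (fun u v => pres_proj (repr u * repr v)).
Definition pres_scale : R -> pres_alg -> pres_alg :=
  locked (fun c u => pres_proj (c *: repr u)).

Lemma pres_projM : {morph pres_proj : x y / x * y >-> pres_mul x y}.
Proof.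
move=> x y; rewrite /pres_mul -lock; apply/pres_projP.
have E (a b c d : free_alg) : a * b - c * d = (a - c) * b - c * (d - b).
  by rewrite mulrBl mulrBr opprB addrA subrK.
rewrite E.
apply: rel_idealB; [apply: rel_idealMr | apply: rel_idealMl];
  by apply/pres_projP; rewrite /pres_proj reprK.
Qed.

Lemma pres_projZ c : {morph pres_proj : x / c *: x >-> pres_scale c x}.
Proof.
move=> x; rewrite /pres_scale -lock; apply/pres_projP; rewrite -scalerBr -[_ - _]mul1r scalerAl.
by apply/rel_idealMl/pres_projP; rewrite /pres_proj reprK.
Qed.

Lemma pres_mulA : associative pres_mul.
Proof.
move=> u v w; have [[x ->] [y ->] [z ->]] :=
  And3 (pres_proj_surj u) (pres_proj_surj v) (pres_proj_surj w).
by rewrite -!pres_projM mulrA.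
Qed.

Lemma pres_mul1 : left_id pres_one pres_mul.
Proof. by move=> u; have [x ->] := pres_proj_surj u; rewrite -pres_projM mul1r. Qed.

Lemma pres_mulr1 : right_id pres_one pres_mul.
Proof. by move=> u; have [x ->] := pres_proj_surj u; rewrite -pres_projM mulr1. Qed.

Lemma pres_mulDl : left_distributive pres_mul +%R.
Proof.
move=> u v w; have [[x ->] [y ->] [z ->]] :=
  And3 (pres_proj_surj u) (pres_proj_surj v) (pres_proj_surj w).
by rewrite -pres_projD -!pres_projM -pres_projD mulrDl.
Qed.

Lemma pres_mulDr : right_distributive pres_mul +%R.
Proof.
move=> u v w; have [[x ->] [y ->] [z ->]] :=
  And3 (pres_proj_surj u) (pres_proj_surj v) (pres_proj_surj w).
by rewrite -pres_projD -!pres_projM -pres_projD mulrDr.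
Qed.

HB.instance Definition _ := GRing.Zmodule_isPzRing.Build pres_alg
  pres_mulA pres_mul1 pres_mulr1 pres_mulDl pres_mulDr.

Lemma pres_scaleA a b u : pres_scale a (pres_scale b u) = pres_scale (a * b) u.
Proof. by have [x ->] := pres_proj_surj u; rewrite -!pres_projZ scalerA. Qed.

Lemma pres_scale1 : left_id 1 pres_scale.
Proof. by move=> u; have [x ->] := pres_proj_surj u; rewrite -pres_projZ scale1r. Qed.

Lemma pres_scaleDr : right_distributive pres_scale +%R.
Proof.
move=> a u v; have [[x ->] [y ->]] :=
  conj (pres_proj_surj u) (pres_proj_surj v).
by rewrite -pres_projD -!pres_projZ -pres_projD scalerDr.
Qed.

Lemma pres_scaleDl u : {morph pres_scale^~ u : a b / a + b}.
Proof.
move=> a b /=; have [x ->] := pres_proj_surj u.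
by rewrite -!pres_projZ -pres_projD scalerDl.
Qed.

HB.instance Definition _ := GRing.Zmodule_isLmodule.Build R pres_alg
  pres_scaleA pres_scale1 pres_scaleDr pres_scaleDl.

Lemma pres_scaleAl (c : R) (u v : pres_alg) : c *: (u * v) = c *: u * v.
Proof.
have [[x ->] [y ->]] := conj (pres_proj_surj u) (pres_proj_surj v).
have ME x' y' : pres_proj x' * pres_proj y' = pres_proj (x' * y').
  by rewrite pres_projM.
have ZE x' : c *: pres_proj x' = pres_proj (c *: x') by rewrite pres_projZ.
by rewrite ME !ZE ME scalerAl.
Qed.

Lemma pres_scaleAr (c : R) (u v : pres_alg) : c *: (u * v) = u * (c *: v).
Proof.
have [[x ->] [y ->]] := conj (pres_proj_surj u) (pres_proj_surj v).
have ME x' y' : pres_proj x' * pres_proj y' = pres_proj (x' * y').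
  by rewrite pres_projM.
have ZE x' : c *: pres_proj x' = pres_proj (c *: x') by rewrite pres_projZ.
by rewrite ME !ZE ME free_alg_scalerAr.
Qed.

HB.instance Definition _ := GRing.isZmodMorphism.Build free_alg pres_alg
  pres_proj pres_projB.
HB.instance Definition _ := GRing.isMonoidMorphism.Build free_alg pres_alg
  pres_proj (erefl, pres_projM).
HB.instance Definition _ := GRing.isScalable.Build R free_alg pres_alg *:%R
  pres_proj pres_projZ.

Lemma pres_rel x y : rel x y -> pres_proj x = pres_proj y.
Proof. by move=> xy; apply/pres_projP; exact: rel_ideal_gen. Qed.

Lemma pres_alg_nontrivial (S : pzRingType) (f : {rmorphism free_alg -> S}) :
  (1 : S) <> 0 -> (forall x y, rel x y -> f x = f y) -> (1 : pres_alg) != 0.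
Proof.
move=> nz fP; suff fI x : rel_ideal x -> f x = 0.
  apply/eqP => E; have /pres_projP : pres_proj 1 = pres_proj 0 by rewrite raddf0.
  by rewrite subr0 => /fI; rewrite rmorph1.
elim=> [y z /fP yz||y z _ fy _ fz|z y _ fy|z y _ fy].
- by rewrite rmorphB yz subrr.
- exact: rmorph0.
- by rewrite rmorphB fy fz subr0.
- by rewrite rmorphM fy mulr0.
- by rewrite rmorphM fy mul0r.
Qed.

End PresentedAlgebra.

(* A = Z[a, v]; the type is not written {mpoly int[2]} because monalg
   redefines that notation. *)
Definition baseA : Type := mpoly 2 int.
HB.instance Definition _ := GRing.ComNzRing.on baseA.

Definition var_a : baseA := 'X_0.
Definition var_v : baseA := 'X_1.
Definition var_q : baseA := var_v ^+ 2.

Section Setting.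

(* For n >= 1, n.-1.+1 is n, the size of the matrices in {'GL_n[F]}. *)
Variables (F : finFieldType) (n : nat) (Fb : {group {unit F}}).

Local Notation GL := {'GL_n[F]}.

Lemma perm_mx_is_unit (s : 'S_n.-1.+1) :
  (perm_mx s : 'M[F]_n.-1.+1) \is a GRing.unit.
Proof. exact: unitmx_perm. Qed.

Definition perm_gl (s : 'S_n.-1.+1) : GL := FinRing.unit _ (perm_mx_is_unit s).

Lemma diag_mx_is_unit (f : 'I_n.-1.+1 -> {unit F}) :
  diag_mx (\row_k FinRing.uval (f k)) \is a GRing.unit.
Proof.
rewrite -[_ \is a _]/(_ \in unitmx) unitmxE det_diag unitfE.
by apply/prodf_neq0 => k _; rewrite mxE -unitfE; exact: valP.
Qed.

Definition diag_gl (f : 'I_n.-1.+1 -> {unit F}) : GL :=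
  FinRing.unit _ (diag_mx_is_unit f).

Definition permW : {set GL} := [set x : GL | is_perm_mx (GLval x)].

Definition diagH : {set GL} :=
  [set x : GL | [exists f : {ffun 'I_n.-1.+1 -> {unit F}},
     [forall k, f k \in Fb] && (x == diag_gl f)]].

Local Open Scope group_scope.

Definition WH : {set GL} := permW * diagH.

(* Indices are 0-based: sgen i is the permutation matrix of the
   transposition (i, i+1) of {0, ..., n-1}. *)
Definition sgen (i : 'I_n.-1) : GL := perm_gl (adj_tperm i).

Definition hdiag1 (j : 'I_n.-1.+1) (alpha : {unit F}) : GL :=
  diag_gl (fun k => if k == j then alpha else 1).

Definition unit_m1 : {unit F} := FinRing.unit F (unitrN1 F).

(* b = #|Fb|. *)
Definition hdiag2 (j k : 'I_n.-1.+1) (alpha : {unit F}) : GL :=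
  hdiag1 j alpha * hdiag1 k (unit_m1 ^+ #|Fb|.-1 * alpha^-1).

Definition Xset (i : 'I_n.-1) : {set GL} :=
  [set hdiag2 (adj_lo i) (adj_hi i) alpha | alpha in Fb].

Lemma perm_glM s t : perm_gl (s * t) = perm_gl s * perm_gl t.
Proof. by apply: val_inj; rewrite /= perm_mxM. Qed.

Lemma perm_gl1 : perm_gl 1 = 1.
Proof. by apply: val_inj; rewrite /= perm_mx1. Qed.

Lemma perm_gl_inj : injective perm_gl.
Proof.
move=> s t /(congr1 val) /= /matrixP st; apply/permP => i.
have := st i (s i); rewrite !mxE eqxx; case: eqP => // _ /eqP.
by rewrite oner_eq0.
Qed.

Lemma permWP x : reflect (exists s, x = perm_gl s) (x \in permW).
Proof.
rewrite inE; apply: (iffP (is_perm_mxP _)) => -[s sE]; exists s.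
  exact: val_inj.
by rewrite sE.
Qed.

Lemma permW_group_set : group_set permW.
Proof.
apply/group_setP; split; first by apply/permWP; exists 1; rewrite perm_gl1.
move=> _ _ /permWP[s ->] /permWP[t ->].
by apply/permWP; exists (s * t); rewrite perm_glM.
Qed.
Canonical permW_group := Group permW_group_set.

Lemma diag_glM f g : diag_gl (fun k => f k * g k) = diag_gl f * diag_gl g.
Proof.
apply: val_inj; rewrite /= -[RHS]/(_ *m _) mulmx_diag; congr diag_mx.
by apply/rowP => k; rewrite !mxE.
Qed.

Lemma eq_diag_gl f g : f =1 g -> diag_gl f = diag_gl g.
Proof.
move=> fg; apply: val_inj => /=; congr diag_mx.
by apply/rowP => k; rewrite !mxE fg.
Qed.

Lemma diag_gl1 : diag_gl (fun=> 1) = 1.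
Proof.
apply: val_inj => /=; rewrite -[RHS]/(1%:M) -diag_const_mx; congr diag_mx.
by apply/rowP => k; rewrite !mxE.
Qed.

Lemma diagHP x :
  reflect (exists2 f, forall k, f k \in Fb & x = diag_gl f) (x \in diagH).
Proof.
rewrite inE; apply: (iffP existsP) => [[f /andP[/forallP fFb /eqP->]]|[f fFb ->]].
  by exists f.
exists (finfun f); apply/andP; split; first by apply/forallP => k; rewrite ffunE.
by apply/eqP/eq_diag_gl => k; rewrite ffunE.
Qed.

Lemma diagH_group_set : group_set diagH.
Proof.
apply/group_setP; split.
  by apply/diagHP; exists (fun=> 1) => //; rewrite diag_gl1.
move=> _ _ /diagHP[f fFb ->] /diagHP[g gFb ->]; apply/diagHP.
by exists (fun k => f k * g k) => [k|]; rewrite ?groupM ?diag_glM.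
Qed.
Canonical diagH_group := Group diagH_group_set.

Lemma diag_glJ f s : diag_gl f ^ perm_gl s = diag_gl (fun k => f ((s^-1)%g k)).
Proof.
rewrite conjgE; apply: (mulgI (perm_gl s)); rewrite !mulgA mulgV mul1g.
apply: val_inj; rewrite /= -[LHS]/(_ *m _) -[RHS]/(_ *m _) -row_permE.
rewrite -[perm_mx s]/(perm_mx s) -{1}(invgK s) -col_permE.
apply/matrixP => i j; rewrite !mxE permK.
by rewrite -(inj_eq (@perm_inj _ s)) permKV.
Qed.

Lemma sgen2 i : sgen i * sgen i = 1.
Proof. by rewrite /sgen -perm_glM tperm2 perm_gl1. Qed.

Lemma sgenV i : (sgen i)^-1 = sgen i.
Proof. by apply: (mulIg (sgen i)); rewrite mulVg sgen2. Qed.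

Lemma permW_normH : permW \subset 'N(diagH).
Proof.
apply/normsP => _ /permWP[s ->]; apply/eqP; rewrite eqEcard cardJg leqnn andbT.
apply/subsetP => _ /imsetP[_ /diagHP[f fFb ->] ->].
by rewrite diag_glJ; apply/diagHP; exists (fun k => f ((s^-1)%g k)).
Qed.

Lemma WH_group_set : group_set WH.
Proof. exact/comm_group_setP/normC/permW_normH. Qed.
Canonical WH_group := Group WH_group_set.

Lemma unit_m1_in : unit_m1 ^+ #|Fb|.-1 \in Fb.
Proof.
have m1sq : unit_m1 ^+ 2 = 1 by apply: val_inj; rewrite /= mulrNN mulr1.
have [odd_b|] := boolP (odd #|Fb|).
  rewrite -[X in _ ^+ X]odd_double_half -subn1 oddB ?cardG_gt0 // odd_b /= add0n.
  by rewrite -mul2n expgM m1sq expg1n group1.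
rewrite -dvdn2 => /(Cauchy (isT : prime 2))[x xFb ox]; apply: groupX.
suff -> : unit_m1 = x by [].
have : x * x = 1 by rewrite -[RHS](expg_order x) ox expgS expg1.
move=> /(congr1 FinRing.uval)/= /eqP; rewrite -expr2 -subr_eq0 subr_sqr_1 mulf_eq0 subr_eq0 addr_eq0 => /orP[]/eqP xE.
  have x1 : x = 1 by apply: val_inj.
  by move: ox; rewrite x1 order1.
by apply: val_inj.
Qed.

Lemma hdiag1_in j alpha : alpha \in Fb -> hdiag1 j alpha \in diagH.
Proof.
move=> aFb; apply/diagHP; exists (fun k => if k == j then alpha else 1) => //.
by move=> k; case: eqP.
Qed.

Lemma Xset_subH i : Xset i \subset diagH.
Proof.
apply/subsetP => _ /imsetP[alpha aFb ->].
by rewrite groupM // hdiag1_in // groupM ?groupV ?unit_m1_in.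
Qed.

Lemma permW_tiH : permW :&: diagH = 1.
Proof.
apply/trivgP/subsetP => _ /setIP[/permWP[s ->] /diagHP[f _ /(congr1 val)/= sf]].
suff -> : s = 1 by rewrite perm_gl1 inE.
apply/permP => i; rewrite perm1; move/matrixP: sf => /(_ i (s i)).
rewrite !mxE eqxx; case: (i =P s i) => [/esym//|_].
by move/eqP; rewrite oner_eq0.
Qed.

Definition sword (w : seq 'I_n.-1) : GL := \prod_(i <- w) sgen i.

Definition is_expr (x : GL) (p : nat) : bool :=
  [exists w : p.-tuple 'I_n.-1, sword w == x].

(* The value 0 outside W is never used. *)
Definition cox_length (x : GL) : nat :=
  if pselect (exists p, is_expr x p) is left e then ex_minn e else 0.

Definition reduced_expr (x : GL) (w : seq 'I_n.-1) : bool :=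
  (sword w == x) && (size w == cox_length x).

Definition some_reduced_expr (x : GL) : seq 'I_n.-1 :=
  if pselect (exists w, reduced_expr x w) is left e then xchoose e else [::].

Local Open Scope ring_scope.

Definition hgen : Type := ('I_n.-1 + subg_of [group of diagH])%type.
HB.instance Definition _ := Choice.on hgen.

Local Notation free := (free_alg baseA hgen).
Definition free_s (i : 'I_n.-1) : free := free_gen baseA (inl i : hgen).
Definition free_d (d : subg_of [group of diagH]) : free :=
  free_gen baseA (inr d : hgen).

(* hecke_rel_1 is the identification of the generator t_d at d = 1 with the
   empty product t_w at w = 1, i.e. with the identity, which the notation t_x
   presupposes. The other relations make t_1 only a central idempotent, and
   without this one the algebra gains a nonzero summand on which all t_d
   vanish. In hecke_rel_ds, e is s_i d s_i, which lies in H_b because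
   permutation matrices normalize H_b, see t_ds. *)
Inductive hecke_rel : free -> free -> Prop :=
| hecke_rel_1 : hecke_rel (free_d 1%g) 1
| hecke_rel_dd d e : hecke_rel (free_d d * free_d e) (free_d (d * e)%g)
| hecke_rel_ds d e i : sgval e = (sgen i * sgval d * sgen i)%g ->
    hecke_rel (free_d d * free_s i) (free_s i * free_d e)
| hecke_rel_comm (i j : 'I_n.-1) : (i.+1 < j)%N || (j.+1 < i)%N ->
    hecke_rel (free_s i * free_s j) (free_s j * free_s i)
| hecke_rel_braid (i j : 'I_n.-1) : j = i.+1 :> nat ->
    hecke_rel (free_s i * free_s j * free_s i) (free_s j * free_s i * free_s j)
| hecke_rel_quad i :
    hecke_rel (free_s i ^+ 2)
      (var_q *: 1
       + var_a *: \sum_(d : subg_of [group of diagH] | sgval d \in Xset i)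
                    (free_d d * free_s i)).

(* The algebra is nonzero, as [algType] requires: evaluate at a = 0, v = 1 and
   send all generators to 1. *)
Definition spec_scal : baseA -> int := meval (fun i : 'I_2 => (i : nat)%:Z).
HB.instance Definition _ := GRing.RMorphism.on spec_scal.
Definition spec_mon (_ : {fmonom hgen}) : int := 1.
Lemma spec_mon_morph : mmorphism spec_mon.
Proof. by split. Qed.
HB.instance Definition _ := monalg.isMultiplicative.Build _ _ spec_mon spec_mon_morph.
Definition spec : free -> int := monalg.mmap spec_scal spec_mon.
HB.instance Definition _ := GRing.RMorphism.on spec.

Lemma spec_gen g : spec (free_gen baseA g) = 1.
Proof.
rewrite /free_gen -lock -[RHS](rmorph1 spec_scal) -[RHS]mulr1.
exact: (monalg.mmapU (f := spec_scal) (h := spec_mon)).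
Qed.

Lemma spec_rel x y : hecke_rel x y -> spec x = spec y.
Proof.
have [va vv] : spec_scal var_a = 0 /\ spec_scal var_v = 1.
  by rewrite /spec_scal !mevalXU.
(* Over an abstract algebra in place of [free], see [locked] above. *)
have H (B : algType baseA) (f : {rmorphism B -> int}) :
    (forall c z, f (c *: z) = spec_scal c * f z) ->
  [/\ forall u v, f u = 1 -> f v = 1 -> f (u * v) = 1,
      f 1 = 1 &
      forall u w, f u = 1 -> f (u ^+ 2) = f (var_q *: 1 + var_a *: w)].
  move=> fZ; split=> [u v fu fv||u w fu]; rewrite ?rmorph1 //.
    by rewrite rmorphM fu fv.
  rewrite rmorphXn /= fu expr1n rmorphD /= !fZ rmorph1 va mul0r addr0 mulr1.
  by rewrite /var_q (rmorphXn spec_scal) /= vv expr1n.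
have [sM s1 sQ] := H free spec
  (monalg.mmapZ (f := spec_scal) (h := spec_mon)).
case=> [|d e|d e i _|i j _|i j _|i].
- by apply: etrans (esym s1); exact: spec_gen.
- apply: etrans (sM _ _ _ _) _; [exact: spec_gen | exact: spec_gen |].
  by apply: esym; exact: spec_gen.
- apply: etrans (sM _ _ _ _) (esym (sM _ _ _ _)); exact: spec_gen.
- apply: etrans (sM _ _ _ _) (esym (sM _ _ _ _)); exact: spec_gen.
- apply: etrans (sM _ _ (sM _ _ _ _) _) (esym (sM _ _ (sM _ _ _ _) _));
    exact: spec_gen.
- by apply: sQ; exact: spec_gen.
Qed.

Definition hecke : Type := pres_alg hecke_rel.
HB.instance Definition _ := GRing.PzRing.on hecke.
HB.instance Definition _ := GRing.Lmodule.on hecke.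

Lemma hecke_1_neq0 : (1 : hecke) != 0.
Proof.
apply: (pres_alg_nontrivial (f := spec)); first exact/eqP/oner_neq0.
exact: spec_rel.
Qed.

HB.instance Definition _ := GRing.PzSemiRing_isNonZero.Build hecke hecke_1_neq0.
HB.instance Definition _ := GRing.Lmodule_isLalgebra.Build baseA hecke
  (@pres_scaleAl _ _ hecke_rel).
HB.instance Definition _ := GRing.Lalgebra_isAlgebra.Build baseA hecke
  (@pres_scaleAr _ _ hecke_rel).

Definition t_s (i : 'I_n.-1) : hecke := pres_proj hecke_rel (free_s i).

(* Meaningful for d in H_b only. *)
Definition t_d (d : GL) : hecke :=
  pres_proj hecke_rel (free_d (subg [group of diagH] d)).

(* t_wE shows that any reduced expression gives the same element. *)
Definition t_w (w : GL) : hecke := \prod_(i <- some_reduced_expr w) t_s i.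

(* x = divgr W H_b x * remgr W H_b x is the factorization of x in W H_b as wd;
   t_wd and t_dw show that both defining rules for t_x hold. *)
Definition t_ (x : GL) : hecke :=
  t_w (divgr permW diagH x) * t_d (remgr permW diagH x).

Lemma t_d1 : t_d 1%g = 1.
Proof.
rewrite /t_d; have -> : subg [group of diagH] 1%g = 1%g.
  by apply: val_inj; rewrite /= subgK.
by rewrite (pres_rel hecke_rel_1).
Qed.

Lemma t_dM d e : d \in diagH -> e \in diagH -> t_d d * t_d e = t_d (d * e)%g.
Proof.
move=> dH eH; rewrite /t_d subgM //.
by rewrite -(pres_rel (hecke_rel_dd _ _)) rmorphM.
Qed.

Lemma t_ds d i : d \in diagH ->
  t_d d * t_s i = t_s i * t_d (sgen i * d * sgen i)%g.
Proof.
move=> dH; have eH : (sgen i * d * sgen i)%g \in diagH.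
  have sW : sgen i \in permW by apply/permWP; exists (adj_tperm i).
  by rewrite -{1}[sgen i]sgenV -mulgA -conjgE memJ_norm // (subsetP permW_normH).
rewrite /t_d /t_s -[LHS]rmorphM -[RHS]rmorphM; apply: pres_rel.
by apply: hecke_rel_ds; rewrite !subgK.
Qed.

Lemma t_sC (i j : 'I_n.-1) : (i.+1 < j)%N || (j.+1 < i)%N ->
  t_s i * t_s j = t_s j * t_s i.
Proof.
move=> ij; rewrite -[LHS]rmorphM -[RHS]rmorphM.
exact: pres_rel (hecke_rel_comm ij).
Qed.

Lemma t_s_braid (i j : 'I_n.-1) : j = i.+1 :> nat ->
  t_s i * t_s j * t_s i = t_s j * t_s i * t_s j.
Proof.
have tE h k l : t_s h * t_s k * t_s l =
    pres_proj hecke_rel (free_s h * free_s k * free_s l).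
  by rewrite [RHS]rmorphM [X in _ = X * _]rmorphM.
move=> ij; rewrite !tE; exact: pres_rel (hecke_rel_braid ij).
Qed.

Lemma t_s_sqr i :
  t_s i ^+ 2 = var_q *: 1 + var_a *: \sum_(d in Xset i) t_d d * t_s i.
Proof.
have pZ c z : pres_proj hecke_rel (c *: z) = c *: (pres_proj hecke_rel z : hecke).
  exact: pres_projZ.
rewrite -[LHS]rmorphXn [LHS](pres_rel (hecke_rel_quad _)).
apply: etrans (pres_projD _ _ _) _.
apply: (f_equal2 (fun u w : hecke => u + w)); apply: etrans (pZ _ _) _.
  by apply: (f_equal (fun u : hecke => _ *: u)); exact: rmorph1.
apply: (f_equal (fun u : hecke => _ *: u)).
rewrite [LHS]rmorph_sum /=.
rewrite [RHS](reindex_onto sgval (subg [group of diagH])) /=; last first.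
  by move=> d /(subsetP (Xset_subH i)) dH; rewrite subgK.
apply: eq_big => [d|d _]; first by rewrite sgvalK eqxx andbT.
by rewrite [LHS]rmorphM /t_d sgvalK.
Qed.

Lemma sword_perm w : sword w = perm_gl (perm_word w).
Proof.
rewrite /sword /perm_word; elim/big_rec2: _ => [|i x y _ ->].
  by rewrite perm_gl1.
by rewrite perm_glM.
Qed.

Lemma is_exprP x p : reflect (exists2 w, size w = p & sword w = x) (is_expr x p).
Proof.
apply: (iffP existsP) => [[w /eqP wx]|[w /eqP wp wx]].
  by exists w => //; rewrite size_tuple.
by exists (Tuple wp); apply/eqP.
Qed.

Lemma cox_length_perm s : cox_length (perm_gl s) = #|inversions s|.
Proof.
have [w wE szw] := perm_word_exists s.
have ex : exists p, is_expr (perm_gl s) p.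
  by exists (size w); apply/is_exprP; exists w; rewrite // sword_perm wE.
rewrite /cox_length; case: pselect => // e; case: ex_minnP => p.
move=> /is_exprP[u <- uE] minp; apply/eqP; rewrite eqn_leq; apply/andP; split.
  by rewrite -szw; apply/minp/is_exprP; exists w; rewrite // sword_perm wE.
by move: uE; rewrite sword_perm => /perm_gl_inj <-; exact: inversions_perm_word.
Qed.

Lemma some_reduced_exprP x : x \in permW -> reduced_expr x (some_reduced_expr x).
Proof.
move=> /permWP[s ->]; rewrite /some_reduced_expr; case: pselect => [e|ne].
  exact: xchooseP.
case: ne; have [w wE szw] := perm_word_exists s; exists w.
by rewrite /reduced_expr sword_perm wE cox_length_perm szw !eqxx.
Qed.

Lemma t_wE w u : w \in permW -> reduced_expr w u -> t_w w = \prod_(i <- u) t_s i.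
Proof.
move=> wW /andP[/eqP uw /eqP su]; have /andP[/eqP vw /eqP sv] := some_reduced_exprP wW.
rewrite /t_w; move: (some_reduced_expr w) vw sv => v vw sv.
have uv : perm_word v = perm_word u.
  by apply: perm_gl_inj; rewrite -!sword_perm uw vw.
have lenE : cox_length w = #|inversions (perm_word u)|.
  by rewrite -uw sword_perm cox_length_perm.
apply: perm_word_matsumoto => //; last 2 first.
- by rewrite uv sv.
- by rewrite su.
- by move=> i j ij; apply: t_sC; rewrite ij.
- exact: t_s_braid.
Qed.

Lemma t_wd w d : w \in permW -> d \in diagH -> t_ (w * d)%g = t_w w * t_d d.
Proof.
move=> wW dH; rewrite /t_ divgrMid ?remgrMid ?permW_tiH //.
Qed.

Lemma t_dw d w : d \in diagH -> w \in permW -> t_ (d * w)%g = t_d d * t_w w.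
Proof.
move=> dH wW; rewrite conjgC t_wd ?memJ_norm ?(subsetP permW_normH) //.
have /andP[/eqP uw _] := some_reduced_exprP wW.
rewrite -{2}uw /t_w; elim: (some_reduced_expr w) d dH => [|i u IHu] d dH.
  by rewrite /sword !big_nil conjg1 mul1r mulr1.
rewrite /sword !big_cons mulrA t_ds // -!mulrA -/(sword u) conjgM.
have -> : (sgen i * d * sgen i = d ^ sgen i)%g.
  by rewrite conjgE sgenV mulgA.
rewrite IHu // memJ_norm // (subsetP permW_normH) //.
by apply/permWP; exists (adj_tperm i).
Qed.

End Setting.

Arguments WH {F} n Fb.
Arguments hecke {F} n Fb.
Arguments t_ {F} n Fb x.

Definition is_basis_on (R : pzRingType) (V : lmodType R) (I : finType)
    (D : {set I}) (v : I -> V) : Prop :=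
  (forall u : V, exists c : I -> R, u = \sum_(x in D) c x *: v x) /\
  (forall c : I -> R, \sum_(x in D) c x *: v x = 0 ->
     forall x, x \in D -> c x = 0).

(* Main.v *)
Require Import Defs.
From HB Require Import structures.
From mathcomp Require Import all_boot all_order all_algebra all_fingroup.
From mathcomp Require Import finmap monalg.

(* The elements t_x span because their span contains 1 and is stable under left
   multiplication by the generators. They are independent because H acts on the
   free module with basis the pairs (w, g) by the formulas that left
   multiplication must satisfy: t_d translates (w, g) by the conjugate of d by w,
   and t_s sends (w, g) to (sw, g) if sw > w, and to q (sw, g) plus a times the
   translates of (w, g) by the conjugates by w of X_s if sw < w. Then t_w t_d
   sends (1, 1) to the basis vector indexed by (w, d). The braid relation is
   checked at each w, according to the relative order of three values of w. *)

Set Implicit Arguments.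
Unset Strict Implicit.
Unset Printing Implicit Defensive.

Import GRing.Theory.
Local Open Scope ring_scope.

(** * Modules over the free algebra, and induction in the presented algebra *)

Section FreeAlgebraAction.

Variables (R : comNzRingType) (I : choiceType) (M : lmodType R).
Variable op : I -> {linear M -> M}.

Definition word_act (w : seq I) : M -> M := fun z => foldr (fun i y => op i y) z w.

Lemma word_act_linear w : linear (word_act w).
Proof. by elim: w => //= i w IHw c y z; rewrite /word_act /= -!/(word_act w _) IHw linearP. Qed.
HB.instance Definition _ w :=
  GRing.isLinear.Build R M M *:%R (word_act w) (word_act_linear w).

Lemma word_act_cat u v z : word_act (u ++ v) z = word_act u (word_act v z).
Proof. exact: foldr_cat. Qed.

(* [locked] keeps unification from unfolding the sum. *)
Definition free_act : free_alg R I -> M -> M := locked (fun x z =>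
  \sum_(k <- msupp (x : {malg R[{fmonom I}]})) mcoeff k x *: word_act k z).

Lemma free_actE (x : {malg R[{fmonom I}]}) z :
  free_act x z = \sum_(k <- msupp x) mcoeff k x *: word_act k z.
Proof. by rewrite /free_act -lock. Qed.

Lemma free_actEw (d : {fset {fmonom I}}) (x : {malg R[{fmonom I}]}) z :
  (msupp x `<=` d)%fset -> free_act x z = \sum_(k <- d) mcoeff k x *: word_act k z.
Proof.
move=> le_xd; rewrite free_actE (big_fset_incl _ le_xd) // => k _ kx.
by rewrite mcoeff_outdom // scale0r.
Qed.

Lemma free_actB x y z : free_act (x - y) z = free_act x z - free_act y z.
Proof.
pose d := (msupp (x : {malg R[{fmonom I}]}) `|` msupp (y : {malg R[{fmonom I}]}))%fset.
rewrite (@free_actEw d) ?msuppB_le // (@free_actEw d x) ?fsubsetUl //.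
rewrite (@free_actEw d y) ?fsubsetUr // -sumrB.
by apply: eq_bigr => k _; rewrite mcoeffB scalerBl.
Qed.

Lemma free_act0 z : free_act 0 z = 0.
Proof. by rewrite -[0 in LHS](subrr 0) free_actB subrr. Qed.

Lemma free_actD x y z : free_act (x + y) z = free_act x z + free_act y z.
Proof. by rewrite -[y in LHS]opprK -[- y]sub0r !free_actB free_act0 sub0r opprK. Qed.

Lemma free_act_sum J (r : seq J) (P : pred J) (x : J -> free_alg R I) z :
  free_act (\sum_(j <- r | P j) x j) z = \sum_(j <- r | P j) free_act (x j) z.
Proof.
elim/big_rec2: _ => [|j y u _ <-]; [exact: free_act0 | exact: free_actD].
Qed.

Lemma free_actZ c x z : free_act (c *: x) z = c *: free_act x z.
Proof.
rewrite (@free_actEw (msupp (x : {malg R[{fmonom I}]}))) ?msuppZ_le // free_actE scaler_sumr.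
by apply: eq_bigr => k _; rewrite mcoeffZ scalerA.
Qed.

Lemma free_actU c (k : {fmonom I}) z : free_act << c *g k >> z = c *: word_act k z.
Proof.
by rewrite (@free_actEw [fset k]%fset) ?msuppU_le // big_seq_fset1 mcoeffUU.
Qed.

Lemma free_act1 z : free_act 1 z = z.
Proof.
by apply: etrans (free_actU 1 _ z) _; rewrite scale1r fm1.
Qed.

Lemma free_act_gen i z : free_act (free_gen R i) z = op i z.
Proof.
rewrite /free_gen -lock; apply: etrans (free_actU _ _ _) _.
by rewrite scale1r fmU.
Qed.

(** Expanding both factors into monomials reduces this to words, where the product is concatenation
    and [foldr] makes it composition. *)
Lemma free_actM x y z : free_act (x * y) z = free_act x (free_act y z).
Proof.
have -> : x * y = \sum_(k <- msupp (x : {malg R[{fmonom I}]}))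
    \sum_(l <- msupp (y : {malg R[{fmonom I}]}))
    (<< mcoeff k x * mcoeff l y *g monalg.mul k l >> : {malg R[{fmonom I}]}).
  exact: malgME.
rewrite free_act_sum [RHS]free_actE; apply: eq_bigr => k _.
rewrite free_act_sum (free_actE y) raddf_sum scaler_sumr; apply: eq_bigr => l _ /=.
by apply: etrans (free_actU _ _ _) _; rewrite fmM word_act_cat linearZ scalerA.
Qed.

(** The elements that kill all of [M] form a two-sided ideal: left multiples because the action is
    linear in the vector, right multiples because [x] kills every vector. So equations in the
    presented algebra can be tested on [M], although only the free algebra is made to act. *)
Lemma free_act_rel_ideal (rel : free_alg R I -> free_alg R I -> Prop) x :
    (forall y y' z, rel y y' -> free_act y z = free_act y' z) ->
  rel_ideal rel x -> forall z, free_act x z = 0.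
Proof.
move=> rel_act; elim=> {x} [x y xy||x y _ IHx _ IHy|u x _ IHx|u x _ IHx] z.
- by rewrite free_actB (rel_act x y z xy) subrr.
- exact: free_act0.
- by rewrite free_actB IHx IHy subrr.
- by rewrite free_actM IHx free_actE big1 // => k _; rewrite linear0 scaler0.
- by rewrite free_actM IHx.
Qed.

End FreeAlgebraAction.

(** Every element is the image of a linear combination of words, and a word arises from [1] by
    multiplying by generators on the left. Hence for spanning only left multiplications have to be
    studied. *)
Lemma pres_alg_ind (R : comNzRingType) (I : choiceType)
    (rel : free_alg R I -> free_alg R I -> Prop) (P : pres_alg rel -> Prop) :
    P 0 -> (forall u v, P u -> P v -> P (u + v)) ->
    (forall c u, P u -> P (c *: u)) -> P 1 ->
    (forall i u, P u -> P (pres_proj rel (free_gen R i) * u)) ->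
  forall u, P u.
Proof.
move=> P0 PD PZ P1 PM u; have [x ->] := pres_proj_surj u.
have PU (s : seq I) : P (pres_proj rel (<< (FMonom s : {fmonom I}) >> : {malg R[{fmonom I}]})).
  elim: s => [|i s IHs]; first by rewrite -fmoneE; exact: P1.
  have -> : (<< (FMonom (i :: s) : {fmonom I}) >> : {malg R[{fmonom I}]}) =
      free_gen R i * (<< (FMonom s : {fmonom I}) >> : {malg R[{fmonom I}]}) :> free_alg R I.
    rewrite /free_gen -lock; apply: esym; apply: etrans (malgM_def _ _) _.
    apply: etrans (fgmulUU _ _ _ _) _; rewrite mulr1; congr mkmalgU.
    by rewrite fmuE; exact: fmmulE.
  by rewrite rmorphM; exact: PM.
have -> : x = \sum_(k <- msupp (x : {malg R[{fmonom I}]}))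
    mcoeff k x *: (<< k >> : {malg R[{fmonom I}]}) :> free_alg R I.
  rewrite [LHS]monalgE; apply: eq_bigr => k _; apply/malgP => l.
  by rewrite mcoeffZ [LHS]mcoeffU mcoeffU mulr_natr.
elim/big_rec: _ => [|k y _ Py]; first by rewrite rmorph0.
rewrite [pres_proj _ _]pres_projD; apply: PD => //.
rewrite [pres_proj _ _]pres_projZ; apply: PZ; rewrite -[k]fmK; exact: PU.
Qed.

(** Meant for [s] = $t_{s_i}$ and [x] = $t_{w'}$ with [s * x] = $t_w$: the right side then contains
    only $t_{w'}$ and the products $t_d t_w$. *)
Lemma mul_quadratic (R : comNzRingType) (A : algType R) (J : finType)
    (D : {set J}) (t : J -> A) (q a : R) (s x : A) :
    s ^+ 2 = q *: 1 + a *: \sum_(d in D) t d * s ->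
  s * (s * x) = q *: x + a *: \sum_(d in D) t d * (s * x).
Proof.
move=> s2; rewrite mulrA -expr2 s2 mulrDl -!scalerAl mul1r mulr_suml.
by under eq_bigr do rewrite -mulrA.
Qed.

Lemma adj_tpermD m (i : 'I_m) (p : 'I_m.+1) :
  p != i :> nat -> p != i.+1 :> nat -> adj_tperm i p = p.
Proof.
by move=> /negPf pi /negPf pi1; apply: val_inj; rewrite /= adj_tperm_val pi pi1.
Qed.

(** * Operators on functions on the symmetric group that satisfy the quadratic and braid
    relations *)

Section DemazureLusztig.

Variables (R : comNzRingType) (V : lmodType R) (m : nat) (a q : R).
Variable E : 'I_m.+1 -> 'I_m.+1 -> {linear V -> V}.

Hypothesis E_sym : forall x y v, E x y v = E y x v.
Hypothesis E_comm : forall x y z t v, E x y (E z t v) = E z t (E x y v).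
Hypothesis E_absorb : forall x y z v, x != y -> y != z -> x != z ->
  E x y (E x z v) = E x y (E y z v).

Let EZ x y c v : E x y (c *: v) = c *: E x y v. Proof. exact: linearZ. Qed.
Let ED x y u v : E x y (u + v) = E x y u + E x y v. Proof. exact: linearD. Qed.

(* If f w is the coefficient of t_w, this is left multiplication by t_(s_i):
   E x y stands for the sum of the conjugates by w of X_(s_i), where w sends
   i, i+1 to x, y. *)
Definition dl_op (i : 'I_m) (f : {ffun 'S_m.+1 -> V}) : {ffun 'S_m.+1 -> V} :=
  [ffun w : 'S_m.+1 => if (w (adj_lo i) < w (adj_hi i))%N
     then q *: f (adj_tperm i * w)%g
     else f (adj_tperm i * w)%g + a *: E (w (adj_lo i)) (w (adj_hi i)) (f w)].

Lemma dl_op_linear i : linear (dl_op i).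
Proof.
move=> c f g; apply/ffunP => w; rewrite !ffunE; case: ifP => _.
  by rewrite scalerDr !scalerA [q * c]mulrC.
by rewrite linearP !scalerDr !scalerA [a * c]mulrC addrACA.
Qed.
HB.instance Definition _ i :=
  GRing.isLinear.Build R {ffun 'S_m.+1 -> V} {ffun 'S_m.+1 -> V} *:%R
    (dl_op i) (dl_op_linear i).

(** For the Hecke algebra this is the action of the sum of $t_d$ over $d\in X_{s_i}$. *)
Definition dl_refl (i : 'I_m) (f : {ffun 'S_m.+1 -> V}) : {ffun 'S_m.+1 -> V} :=
  [ffun w : 'S_m.+1 => E (w (adj_lo i)) (w (adj_hi i)) (f w)].

(** Exactly one of [w] and $s_iw$ is an ascent, so the factor [q] is picked up once on the way to
    $s_iw$ and back. Symmetry of [E] matters at an ascent, where the [E] term comes from $s_iw$ with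
    its two indices exchanged. *)
Lemma dl_op_sqr i f : dl_op i (dl_op i f) = q *: f + a *: dl_refl i (dl_op i f).
Proof.
apply/ffunP => w; rewrite !ffunE !permM adj_tpermL adj_tpermR adj_tpermK.
have /orP[lt_w|lt_w] := adj_asc_or_desc i w.
  rewrite lt_w ltnNge (ltnW lt_w) /= scalerDr EZ !scalerA.
  by rewrite [q * a]mulrC E_sym.
by rewrite lt_w ltnNge (ltnW lt_w).
Qed.

Lemma dl_op_comm (i j : 'I_m) f : (i.+1 < j)%N ->
  dl_op i (dl_op j f) = dl_op j (dl_op i f).
Proof.
move=> ij.
have ilo : adj_tperm i (adj_lo j) = adj_lo j.
  by rewrite adj_tpermD //= neq_ltn ?(ltnW ij) ?ij orbT.
have ihi : adj_tperm i (adj_hi j) = adj_hi j.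
  by rewrite adj_tpermD //= /bump neq_ltn add1n !ltnS ?(ltnW (ltnW ij)) ?(ltnW ij) orbT.
have jlo : adj_tperm j (adj_lo i) = adj_lo i.
  by rewrite adj_tpermD //= neq_ltn ?ltnS ?(ltnW (ltnW ij)) ?(ltnW ij).
have jhi : adj_tperm j (adj_hi i) = adj_hi i.
  by rewrite adj_tpermD //= /bump add1n neq_ltn ?ltnS ?(ltnW ij) ?ij.
apply/ffunP => w; rewrite !ffunE !permM ilo ihi jlo jhi !mulgA (adj_tperm_comm ij).
case: ifP => _; case: ifP => _ //.
- by rewrite scalerDr EZ !scalerA [q * a]mulrC.
- by rewrite scalerDr EZ !scalerA [q * a]mulrC.
- rewrite !ED !EZ E_comm !scalerDr !scalerA !addrA.
  by rewrite [_ + _ + a *: _]addrAC.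
Qed.

Lemma dl_op_braid (i j : 'I_m) f : j = i.+1 :> nat ->
  dl_op i (dl_op j (dl_op i f)) = dl_op j (dl_op i (dl_op j f)).
Proof.
move=> ij; apply/ffunP => w.
have hilo : adj_hi i = adj_lo j by apply: val_inj; rewrite /= ij.
have jlo : adj_tperm j (adj_lo i) = adj_lo i.
  by rewrite adj_tpermD //= ij neq_ltn ?ltnS ?leqnSn ?leqnn.
have ihi : adj_tperm i (adj_hi j) = adj_hi j.
  by rewrite adj_tpermD //= /bump add1n ij neq_ltn ?ltnS ?leqnSn ?leqnn !orbT.
have jl : adj_tperm j (adj_lo j) = adj_hi j by apply: adj_tpermL.
have jr : adj_tperm j (adj_hi j) = adj_lo j by apply: adj_tpermR.
have il : adj_tperm i (adj_lo i) = adj_lo j by rewrite adj_tpermL.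
have ir : adj_tperm i (adj_lo j) = adj_lo i by rewrite -hilo adj_tpermR.
have wE : (adj_tperm i * (adj_tperm j * (adj_tperm i * w)) =
    adj_tperm j * (adj_tperm i * (adj_tperm j * w)))%g.
  by rewrite !mulgA adj_tperm_braid.
rewrite !ffunE !permM ?hilo ?(jlo, ihi, jl, jr, il, ir) !adj_tpermK wE.
have xy : w (adj_lo i) != w (adj_lo j).
  by rewrite (inj_eq perm_inj) -val_eqE /= ij neq_ltn ltnSn.
have yz : w (adj_lo j) != w (adj_hi j).
  by rewrite (inj_eq perm_inj) -val_eqE /= /bump add1n neq_ltn ltnSn.
have xz : w (adj_lo i) != w (adj_hi j).
  by rewrite (inj_eq perm_inj) -val_eqE /= ij neq_ltn /bump add1n ltnS leqnSn.
(* Every ascent test on either side compares two of the values of [w] at $i$, $i+1$, $i+2$, so the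
   order of these three values decides all branches. *)
move: (w (adj_lo i)) (w (adj_lo j)) (w (adj_hi j)) xy yz xz => x y z xy yz xz.
(* The product of any two different operators among [E x y], [E x z], [E y z] is the same. *)
have E3l v : E x y (E y z v) = E x y (E x z v) by rewrite E_absorb.
have E3r v : E x z (E y z v) = E x y (E x z v).
  rewrite [LHS]E_sym [E y z v]E_sym (E_absorb v _ xy) ?[z == _]eq_sym //.
  by rewrite E_comm [E z x v]E_sym.
case: (ltngtP x y) => [ltxy|ltyx|/val_inj exy]; last by rewrite exy eqxx in xy.
all: case: (ltngtP y z) => [ltyz|ltzy|/val_inj exy]; try by rewrite exy eqxx in yz.
- by rewrite (ltn_trans ltxy ltyz).
- case: (ltngtP x z) => [ltxz|ltzx|/val_inj exy]; last by rewrite exy eqxx in xz.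
  + by rewrite !(EZ, ED, scalerDr, scalerA) [a * _]mulrC.
  + rewrite !(EZ, ED, scalerDr, scalerA) [q * a]mulrC [E y x _]E_sym.
    by rewrite [E y z (E x z _)]E_comm E3r [E x z (E x y _)]E_comm addrACA.
- case: (ltngtP x z) => [ltxz|ltzx|/val_inj exy]; last by rewrite exy eqxx in xz.
  + by rewrite !(EZ, ED, scalerDr, scalerA) [a * _]mulrC.
  + rewrite !(EZ, ED, scalerDr, scalerA) [q * a]mulrC [E z y _]E_sym E3r.
    by rewrite addrACA.
(* For $x>y>z$ each side expands to seven summands. The last ones, cubic in [a], agree once all
   products of [E] are normalized; the other six agree up to order. *)
- rewrite [(x < z)%N]ltnNge (ltnW (ltn_trans ltzy ltyx)) /=.
  rewrite !(EZ, ED, scalerDr, scalerA) !addrA.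
  rewrite ![E y z (E x y _)]E_comm !E3l [E y z (E x z _)]E_comm !E3r.
  by congr (_ + _); rewrite [LHS](ACl (1 * 4 * 3 * 2 * 6 * 5)).
Qed.

Definition perm_delta (w : 'S_m.+1) (v : V) : {ffun 'S_m.+1 -> V} :=
  [ffun u => if u == w then v else 0].

(** The coefficient at $s_iw$, a descent, is taken from [w] with factor $1$; at the ascent [w]
    itself there is no [E] term, so nothing is left there. *)
Lemma dl_op_delta i (w : 'S_m.+1) v : (w (adj_lo i) < w (adj_hi i))%N ->
  dl_op i (perm_delta w v) = perm_delta (adj_tperm i * w)%g v.
Proof.
move=> asc; apply/ffunP => u; rewrite !ffunE.
have -> : (u == adj_tperm i * w)%g = (adj_tperm i * u == w)%g.
  by rewrite -[in RHS](inj_eq (mulgI (adj_tperm i))) adj_tpermK.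
have [uw|_] := eqVneq (adj_tperm i * u)%g w.
  rewrite -uw !permM adj_tpermL adj_tpermR in asc; rewrite ltnNge (ltnW asc) /=.
  case: eqP => [u_w|_]; last by rewrite linear0 scaler0 addr0.
  have /permP/(_ (adj_lo i)) : (adj_tperm i * u = u)%g by rewrite uw -u_w.
  by rewrite permM adj_tpermL => /(congr1 val)/= E_lo; rewrite E_lo ltnn in asc.
case: ifP => [_|desc]; first by rewrite scaler0.
by case: eqP => [uw|_]; [rewrite uw asc in desc | rewrite linear0 scaler0 addr0].
Qed.

(** Read from the right, each letter of a reduced word is an ascent of the product of the letters
    after it. *)
Lemma dl_op_reduced (u : seq 'I_m) v : size u = #|inversions (perm_word u)| ->
  foldr dl_op (perm_delta 1%g v) u = perm_delta (perm_word u) v.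
Proof.
elim: u => [|i u IHu] red_u; first by rewrite /perm_word big_nil.
have [desc /IHu /= ->] := reduced_cons red_u; rewrite perm_word_cons dl_op_delta //.
by move: desc; rewrite perm_word_cons !permM adj_tpermL adj_tpermR.
Qed.

End DemazureLusztig.

(** * The action of the Hecke generators and the check of the defining relations *)

Section Hecke.

Variables (F : finFieldType) (n : nat) (Fb : {group {unit F}}).
Local Notation GL := {'GL_n[F]}.
Local Notation N := n.-1.+1.
Local Notation V := {ffun GL -> baseA^o}.
Local Notation M := {ffun 'S_N -> V}.

(* Right translation, so that [shift] is multiplicative; the indicator function
   of 1 is sent to that of d^-1. *)
Definition shift (d : GL) (v : V) : V := [ffun g => v (g * d)%g].

Lemma shift_linear d : linear (shift d).
Proof. by move=> c u v; apply/ffunP => g; rewrite !ffunE. Qed.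
HB.instance Definition _ d :=
  GRing.isLinear.Build baseA V V *:%R (shift d) (shift_linear d).

Lemma shift1 v : shift 1%g v = v.
Proof. by apply/ffunP => g; rewrite ffunE mulg1. Qed.

Lemma shiftM d e v : shift d (shift e v) = shift (d * e)%g v.
Proof. by apply/ffunP => g; rewrite !ffunE mulgA. Qed.

Lemma unit_mulC (x y : {unit F}) : (x * y = y * x)%g.
Proof. by apply: val_inj; rewrite /= mulrC. Qed.

Lemma diagHC d e : d \in diagH n Fb -> e \in diagH n Fb -> (d * e = e * d)%g.
Proof.
move=> /diagHP[f _ ->] /diagHP[g _ ->]; rewrite -!diag_glM.
by apply: eq_diag_gl => k; exact: unit_mulC.
Qed.

Lemma hdiag2E x y alpha : hdiag2 Fb x y alpha =
  diag_gl (fun k : 'I_N => (if k == x then alpha else 1) *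
    (if k == y then unit_m1 F ^+ #|Fb|.-1 * alpha^-1 else 1))%g.
Proof. by rewrite diag_glM. Qed.

Lemma hdiag2_in (x y : 'I_N) alpha : alpha \in Fb -> hdiag2 Fb x y alpha \in diagH n Fb.
Proof. by move=> aFb; rewrite groupM ?hdiag1_in // groupM ?groupV ?unit_m1_in. Qed.

Lemma hdiag2J (x y : 'I_N) alpha (s : 'S_N) :
  (hdiag2 Fb x y alpha ^ perm_gl F s = hdiag2 Fb (s x) (s y) alpha)%g.
Proof.
rewrite !hdiag2E diag_glJ; apply: eq_diag_gl => k.
by rewrite !(can2_eq (permKV s) (permK s)).
Qed.

Lemma diag_gl_inj (f g : 'I_N -> {unit F}) : diag_gl f = diag_gl g -> f =1 g.
Proof.
move=> /(congr1 val)/= /matrixP fg k; apply: val_inj; have := fg k k.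
by rewrite !mxE eqxx !mulr1n.
Qed.

Lemma hdiag2_inj (x y : 'I_N) : x != y -> injective (hdiag2 Fb x y).
Proof.
move=> /negPf xy alpha beta; rewrite !hdiag2E => /diag_gl_inj/(_ x).
by rewrite eqxx xy !mulg1.
Qed.

(** This is the operator [E x y] of the previous part. *)
Definition torus_sum (x y : 'I_N) (v : V) : V :=
  \sum_(alpha in Fb) shift (hdiag2 Fb x y alpha) v.

Lemma torus_sum_linear x y : linear (torus_sum x y).
Proof.
move=> c u v; rewrite /torus_sum scaler_sumr -big_split.
by apply: eq_bigr => alpha _; rewrite linearP.
Qed.
HB.instance Definition _ x y :=
  GRing.isLinear.Build baseA V V *:%R (torus_sum x y) (torus_sum_linear x y).

(** With $e=(-1)^{b-1}$ one has $h_{x,y}(e\alpha^{-1})=h_{y,x}(\alpha)$, and $\alpha\mapsto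
    e\alpha^{-1}$ permutes $F_b$ because $e\in F_b$. *)
Lemma torus_sum_sym x y v : torus_sum x y v = torus_sum y x v.
Proof.
rewrite /torus_sum; pose e := (unit_m1 F ^+ #|Fb|.-1)%g.
rewrite (reindex_inj (h := fun alpha => e * alpha^-1)%g); last first.
  by move=> alpha beta /mulgI/invg_inj.
apply: eq_big => [alpha|alpha _].
  by rewrite groupMl ?groupV // unit_m1_in.
congr shift; rewrite !hdiag2E; apply: eq_diag_gl => k.
rewrite unit_mulC -/e invMg invgK [(alpha * _)%g]unit_mulC !mulgA mulgV mul1g.
by [].
Qed.

Lemma torus_sum_shift x y d v : d \in diagH n Fb ->
  torus_sum x y (shift d v) = shift d (torus_sum x y v).
Proof.
move=> dH; rewrite /torus_sum linear_sum; apply: eq_bigr => alpha aFb /=.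
by rewrite !shiftM (diagHC dH) // hdiag2_in.
Qed.

Lemma torus_sumC x y z t v :
  torus_sum x y (torus_sum z t v) = torus_sum z t (torus_sum x y v).
Proof.
rewrite [in LHS]/torus_sum [RHS]linear_sum; apply: eq_bigr => alpha aFb /=.
by rewrite torus_sum_shift // hdiag2_in.
Qed.

(* The product of d^-1 with its conjugate by (x y) has the form h_x(c) h_y(c^-1),
   and multiplication by such an element permutes the summands. This is what the
   braid relation rests on. *)
Lemma torus_sumJ x y d v : x != y -> d \in diagH n Fb ->
  torus_sum x y (shift d v) = torus_sum x y (shift (d ^ perm_gl F (tperm x y))%g v).
Proof.
move=> xy /diagHP[f fFb ->]; rewrite diag_glJ tpermV.
(* Conjugation by the transposition exchanges the entries [f x] and [f y]; the quotient
   [f x * (f y)^-1] restores [f x] at [x], and its inverse restores [f y] at [y]. *)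
rewrite /torus_sum [RHS](reindex_inj (mulIg (f x * (f y)^-1))%g).
apply: eq_big => [alpha|alpha aFb]; first by rewrite groupMr // groupM ?groupV.
rewrite !shiftM; congr shift; rewrite !hdiag2E -!diag_glM; apply: eq_diag_gl => k.
have [->|kx] := eqVneq k x.
  by rewrite (negPf xy) tpermL !mulg1 -mulgA mulgKV.
have [->|ky] := eqVneq k y; last by rewrite tpermD 1?eq_sym.
rewrite tpermR !mul1g !invMg invgK -!mulgA; congr (_ * _)%g.
by rewrite [(_ * f x)%g]unit_mulC mulKg unit_mulC.
Qed.

(** Conjugation by the transposition of [x] and [y] takes $h_{x,z}(\alpha)$ to $h_{y,z}(\alpha)$,
    and [torus_sum x y] does not distinguish the two translations. *)
Lemma torus_sum_absorb x y z v : x != y -> y != z -> x != z ->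
  torus_sum x y (torus_sum x z v) = torus_sum x y (torus_sum y z v).
Proof.
move=> xy yz xz; rewrite [torus_sum x z v]/torus_sum [torus_sum y z v]/torus_sum.
rewrite !linear_sum; apply: eq_bigr => alpha aFb /=.
by rewrite torus_sumJ ?hdiag2_in // hdiag2J tpermL tpermD.
Qed.

Definition diag_op (d : GL) (f : M) : M :=
  [ffun w : 'S_N => shift (d ^ perm_gl F w)%g (f w)].

Lemma diag_op_linear d : linear (diag_op d).
Proof. by move=> c f g; apply/ffunP => w; rewrite !ffunE linearP. Qed.
HB.instance Definition _ d :=
  GRing.isLinear.Build baseA M M *:%R (diag_op d) (diag_op_linear d).

Lemma diag_op1 f : diag_op 1%g f = f.
Proof. by apply/ffunP => w; rewrite ffunE conj1g shift1. Qed.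

Lemma diag_opM d e f : diag_op d (diag_op e f) = diag_op (d * e)%g f.
Proof. by apply/ffunP => w; rewrite !ffunE shiftM conjMg. Qed.

Definition simple_op (i : 'I_n.-1) : M -> M :=
  dl_op var_a var_q (fun x y => torus_sum x y : {linear V -> V}) i.
HB.instance Definition _ i := GRing.Linear.on (simple_op i).

Lemma diagHJ d (s : 'S_N) : d \in diagH n Fb -> (d ^ perm_gl F s)%g \in diagH n Fb.
Proof.
move=> /diagHP[f fFb ->]; rewrite diag_glJ.
by apply/diagHP; exists (fun k => f ((s^-1)%g k)).
Qed.

Lemma simple_opE i f (w : 'S_N) : simple_op i f w =
  if (w (adj_lo i) < w (adj_hi i))%N then var_q *: f (adj_tperm i * w)%g
  else f (adj_tperm i * w)%g +
       var_a *: torus_sum (w (adj_lo i)) (w (adj_hi i)) (f w).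
Proof. exact: ffunE. Qed.

Lemma diag_opE d f (w : 'S_N) : diag_op d f w = shift (d ^ perm_gl F w)%g (f w).
Proof. exact: ffunE. Qed.

Lemma diag_simple_op d i f : d \in diagH n Fb ->
  diag_op d (simple_op i f) = simple_op i (diag_op (sgen F i * d * sgen F i)%g f).
Proof.
move=> dH; have -> : (sgen F i * d * sgen F i = d ^ sgen F i)%g.
  by rewrite conjgE sgenV mulgA.
apply/ffunP => w.
rewrite (diag_opE d (simple_op i f) w) [X in shift _ X]simple_opE [RHS]simple_opE.
rewrite (diag_opE _ f w) (diag_opE _ f (_ * w)%g).
have JE : (d ^ perm_gl F w = (d ^ sgen F i) ^ perm_gl F (adj_tperm i * w))%g.
  by rewrite -conjgM -perm_glM mulgA tperm2 mul1g.
case: ifP => _; first by rewrite linearZ JE.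
rewrite linearD linearZ /= JE; congr (_ + _ *: _); rewrite -JE.
(* In the term with [f w] the two sides translate by $d^w$ and by $d^{s_iw}$. These are conjugate
   under the transposition of the values of [w] at $i$ and $i+1$, so [torus_sumJ] identifies
   them. *)
rewrite -torus_sum_shift ?diagHJ // torus_sumJ; last 2 first.
- by rewrite (inj_eq perm_inj) -val_eqE ltn_eqF ?adj_lt.
- exact: diagHJ.
rewrite -!conjgM -!perm_glM.
congr (torus_sum _ _ (shift (d ^ perm_gl F _)%g _)).
by rewrite -tpermJ -conjgC.
Qed.

Lemma simple_op_sqr i f : simple_op i (simple_op i f) =
  var_q *: f + var_a *: \sum_(d in Xset Fb i) diag_op d (simple_op i f).
Proof.
rewrite {1 2}/simple_op dl_op_sqr; last exact: torus_sum_sym.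
congr (_ + _ *: _); rewrite big_imset /=; last first.
  move=> alpha beta _ _; apply: hdiag2_inj.
  by rewrite -val_eqE ltn_eqF ?adj_lt.
apply/ffunP => w; rewrite sum_ffunE ffunE; apply: eq_bigr => alpha _.
by rewrite diag_opE hdiag2J.
Qed.

Definition hecke_op (g : hgen n Fb) : {linear M -> M} :=
  match g with
  | inl i => simple_op i : {linear M -> M}
  | inr d => diag_op (sgval d) : {linear M -> M}
  end.

Local Notation act := (free_act hecke_op).

Lemma act_s i z : act (free_s Fb i) z = simple_op i z.
Proof. exact: (free_act_gen hecke_op (inl i)). Qed.

Lemma act_d d z : act (@free_d _ n Fb d) z = diag_op (sgval d) z.
Proof. exact: (free_act_gen hecke_op (inr d)). Qed.

Lemma hecke_rel_act x y z : hecke_rel x y -> act x z = act y z.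
Proof.
case=> {x y} [|d e|d e i eE|i j ij|i j ij|i].
- by rewrite act_d free_act1 diag_op1.
- by rewrite free_actM !act_d diag_opM.
- rewrite [LHS]free_actM [RHS]free_actM (act_s i z) (act_d d) (act_d e) (act_s i).
  by rewrite diag_simple_op -?eE //; exact: subgP.
- move: (free_s Fb i) (act_s i) (free_s Fb j) (act_s j) => si act_si sj act_sj.
  rewrite [LHS]free_actM [RHS]free_actM !(act_si, act_sj).
  by case/orP: ij => ij; [|apply/esym]; apply: dl_op_comm => // *; exact: torus_sumC.
- move: (free_s Fb i) (act_s i) (free_s Fb j) (act_s j) => si act_si sj act_sj.
  rewrite [LHS]free_actM [LHS]free_actM [RHS]free_actM [RHS]free_actM.
  rewrite !(act_si, act_sj); apply: dl_op_braid => // *;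
    by [exact: torus_sum_sym | exact: torus_sumC | exact: torus_sum_absorb].
rewrite expr2 [LHS]free_actM !act_s simple_op_sqr free_actD.
congr (_ + _); first by rewrite free_actZ free_act1.
rewrite free_actZ free_act_sum; congr (_ *: _).
rewrite (reindex_onto sgval (subg [group of diagH n Fb])) /=; last first.
  by move=> d /(subsetP (Xset_subH Fb i)) dH; rewrite subgK.
apply: eq_big => [d|d _]; first by rewrite sgvalK eqxx andbT.
by rewrite free_actM act_d act_s.
Qed.

End Hecke.

(** * Linear independence of the elements $t_x$ *)

Section Independence.

Variables (F : finFieldType) (n : nat) (Fb : {group {unit F}}).
Local Notation GL := {'GL_n[F]}.
Local Notation N := n.-1.+1.
Local Notation V := {ffun GL -> baseA^o}.
Local Notation M := {ffun 'S_N -> V}.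
Local Notation act := (free_act (@hecke_op F n Fb)).

(** A preimage of $t_x$ in the free algebra, where the action is defined. *)
Definition t_lift (x : GL) : free_alg baseA (hgen n Fb) :=
  (\prod_(i <- some_reduced_expr (divgr (permW F n) (diagH n Fb) x)) free_s Fb i) *
  free_d (subg [group of diagH n Fb] (remgr (permW F n) (diagH n Fb) x)).

Lemma pres_t_lift x : pres_proj (@hecke_rel F n Fb) (t_lift x) = t_ n Fb x.
Proof. by rewrite [LHS]rmorphM [X in X * _]rmorph_prod. Qed.

Lemma perm_gl_in (w : 'S_N) : perm_gl F w \in permW F n.
Proof. by apply/permWP; exists w. Qed.

Lemma WHP (x : GL) : reflect (exists w d, d \in diagH n Fb /\ x = (perm_gl F w * d)%g)
  (x \in WH n Fb).
Proof.
apply: (iffP mulsgP) => [[_ d /permWP[w ->] dH ->]|[w [d [dH ->]]]].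
  by exists w, d.
by exists (perm_gl F w) d => //; exact: perm_gl_in.
Qed.

Lemma act_prod_s (u : seq 'I_n.-1) z :
  act (\prod_(i <- u) free_s Fb i) z = foldr (simple_op Fb (n:=n)) z u.
Proof.
elim: u => [|i u IHu]; first by rewrite big_nil free_act1.
by rewrite big_cons free_actM IHu act_s.
Qed.

Lemma diag_op_delta1 d v :
  diag_op d (perm_delta 1%g v) = perm_delta 1%g (shift d v) :> M.
Proof.
apply/ffunP => w; rewrite diag_opE !ffunE.
by case: eqP => [->|_]; rewrite ?linear0 // perm_gl1 conjg1.
Qed.

Lemma reduced_exprE (w : 'S_N) u : reduced_expr (perm_gl F w) u ->
  perm_word u = w /\ size u = #|inversions w|.
Proof.
move=> /andP[/eqP uw /eqP ->]; rewrite cox_length_perm; split=> //.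
by apply: (@perm_gl_inj F); rewrite -sword_perm.
Qed.

(** First $t_d$ translates the value at the identity permutation, where no conjugation occurs; then
    a reduced word moves the support up to [w]. *)
Lemma act_t_lift (w : 'S_N) d v : d \in diagH n Fb ->
  act (t_lift (perm_gl F w * d)) (perm_delta 1%g v) = perm_delta w (shift d v).
Proof.
move=> dH; rewrite /t_lift divgrMid ?remgrMid ?permW_tiH ?perm_gl_in //.
rewrite free_actM act_d subgK // diag_op_delta1 act_prod_s.
have /reduced_exprE[uE su] := some_reduced_exprP (perm_gl_in w).
have := dl_op_reduced var_a var_q (fun x y => torus_sum Fb x y : {linear V -> V}) (shift d v).
by move=> /(_ (some_reduced_expr (perm_gl F w))); rewrite uE; exact.
Qed.

Lemma t_independent (c : GL -> baseA) :
    \sum_(x in WH n Fb) c x *: t_ n Fb x = 0 ->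
  forall x, x \in WH n Fb -> c x = 0.
Proof.
move=> sum0 _ /WHP[w0 [d0 [d0H ->]]].
(* The lifted combination lies in the ideal of relations, hence acts as zero. *)
pose S := \sum_(x in WH n Fb) c x *: t_lift x.
have /pres_projP : pres_proj (@hecke_rel F n Fb) S = pres_proj _ 0.
  rewrite [RHS]raddf0 -sum0 [LHS]raddf_sum; apply: eq_bigr => x _.
  by rewrite -pres_t_lift; exact: pres_projZ.
rewrite subr0 => /(free_act_rel_ideal (@hecke_rel_act F n Fb)).
pose v : V := [ffun g => (g == 1%g)%:R].
move=> /(_ (perm_delta 1%g v)); rewrite free_act_sum.
(* Since [v] is the indicator function of [1], [shift d v] is that of [d^-1]; evaluation at [w0] and
   [d0^-1] therefore isolates the coefficient of $t_{w_0d_0}$. *)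
move=> /(congr1 (fun f : M => f w0 (d0^-1)%g)).
have actE w d : d \in diagH n Fb ->
    act (c (perm_gl F w * d)%g *: t_lift (perm_gl F w * d)) (perm_delta 1%g v)
      w0 (d0^-1)%g = c (perm_gl F w * d)%g * ((w0 == w) && (d0 == d))%:R.
  move=> dH; rewrite free_actZ act_t_lift //; move: (c _) => cx.
  rewrite !ffunE; case: eqP => _; last by rewrite ffunE scaler0 mulr0.
  by rewrite 2!ffunE -eq_mulVg1.
rewrite !sum_ffunE (bigD1 (perm_gl F w0 * d0)%g) /=; last by apply/WHP; exists w0, d0.
rewrite big1 => [|x /andP[/WHP[w [d [dH ->]]] neq]].
  by rewrite addr0 => /(etrans (esym (actE _ _ d0H))); rewrite !eqxx mulr1 !ffunE.
apply: etrans (actE _ _ dH) _; case: eqP => [w0w|_]; last by rewrite mulr0.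
case: eqP => [d0d|_]; last by rewrite mulr0.
by rewrite w0w d0d eqxx in neq.
Qed.

End Independence.

(** * The span of the elements $t_x$ is the whole algebra *)

Section Spanning.

Variables (F : finFieldType) (n : nat) (Fb : {group {unit F}}).
Local Notation GL := {'GL_n[F]}.
Local Notation N := n.-1.+1.
Local Notation t_w := (@t_w F n Fb).
Local Notation t_d := (@t_d F n Fb).
Local Notation t_s := (@t_s F n Fb).

Definition t_span (u : hecke n Fb) : Prop :=
  exists c : GL -> baseA, u = \sum_(x in WH n Fb) c x *: t_ n Fb x.

Lemma t_span0 : t_span 0.
Proof. by exists (fun=> 0); rewrite big1 // => x _; rewrite scale0r. Qed.

Lemma t_spanD u v : t_span u -> t_span v -> t_span (u + v).
Proof.
move=> [c ->] [d ->]; exists (fun x => c x + d x); rewrite -big_split.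
by apply: eq_bigr => x _; rewrite scalerDl.
Qed.

Lemma t_spanZ c u : t_span u -> t_span (c *: u).
Proof.
move=> [d ->]; exists (fun x => c * d x); rewrite scaler_sumr.
by apply: eq_bigr => x _; rewrite scalerA.
Qed.

Lemma t_span_sum J (r : seq J) (P : pred J) (u : J -> hecke n Fb) :
  (forall j, P j -> t_span (u j)) -> t_span (\sum_(j <- r | P j) u j).
Proof.
by move=> uP; elim/big_rec: _ => [|j v /uP]; [exact: t_span0 | exact: t_spanD].
Qed.

Lemma t_span_t x : x \in WH n Fb -> t_span (t_ n Fb x).
Proof.
move=> xWH; exists (fun y => (y == x)%:R); rewrite (bigD1 x) //= eqxx scale1r.
by rewrite big1 ?addr0 // => y /andP[_ /negPf->]; rewrite scale0r.
Qed.

Lemma t_span_wd (w : 'S_N) d : d \in diagH n Fb ->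
  t_span (t_w (perm_gl F w) * t_d d).
Proof.
by move=> dH; rewrite -t_wd ?perm_gl_in //; apply/t_span_t/WHP; exists w, d.
Qed.

(** Moving [d] to the right of [w] replaces it by its conjugate by [w], which stays in $H_b$ and
    merges with [e]. *)
Lemma t_span_dwd d (w : 'S_N) e : d \in diagH n Fb -> e \in diagH n Fb ->
  t_span (t_d d * (t_w (perm_gl F w) * t_d e)).
Proof.
move=> dH eH; rewrite mulrA -t_dw ?perm_gl_in // conjgC t_wd ?perm_gl_in ?diagHJ //.
by rewrite -mulrA t_dM ?diagHJ //; apply: t_span_wd; rewrite groupM ?diagHJ.
Qed.

(** At an ascent, a reduced word of [w] preceded by [i] is again reduced. *)
Lemma t_s_w i (w : 'S_N) : (w (adj_lo i) < w (adj_hi i))%N ->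
  t_s i * t_w (perm_gl F w) = t_w (perm_gl F (adj_tperm i * w)).
Proof.
move=> asc; have /reduced_exprE[uw su] := some_reduced_exprP (perm_gl_in F w).
rewrite (@t_wE _ _ _ (perm_gl F (adj_tperm i * w))
  (i :: some_reduced_expr (perm_gl F w))) ?perm_gl_in //.
  by rewrite big_cons.
rewrite /reduced_expr sword_perm perm_word_cons uw eqxx /=.
by rewrite cox_length_perm inversions_asc // su.
Qed.

Lemma t_span_Ms i u : t_span u -> t_span (t_s i * u).
Proof.
move=> [c ->]; rewrite mulr_sumr; apply: t_span_sum => _ /WHP[w [d [dH ->]]].
rewrite -scalerAr; apply: t_spanZ; rewrite t_wd ?perm_gl_in // mulrA.
have /orP[asc|desc] := adj_asc_or_desc i w.
  by rewrite t_s_w //; exact: t_span_wd.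
(* At a descent, $t_w=t_{s_i}t_{w'}$. The quadratic relation then turns $t_{s_i}t_w$ into a
   combination of $t_{w'}$ and the $t_et_w$ with $e\in X_{s_i}$, with no simple generator left to
   multiply by. *)
pose w' := (adj_tperm i * w)%g.
have asc : (w' (adj_lo i) < w' (adj_hi i))%N.
  by rewrite !permM adj_tpermL adj_tpermR.
have twE : t_w (perm_gl F w) = t_s i * t_w (perm_gl F w').
  by have := t_s_w asc; rewrite [in RHS]adj_tpermK => /esym.
have quad : t_s i * t_w (perm_gl F w) = var_q *: t_w (perm_gl F w') +
    var_a *: \sum_(e in Xset Fb i) t_d e * t_w (perm_gl F w).
  by move: (t_w (perm_gl F w)) twE => _ ->; exact: mul_quadratic (t_s_sqr Fb i).
rewrite [X in X * _]quad [X in t_span X]mulrDl; apply: t_spanD; rewrite -[X in t_span X]scalerAl.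
  by apply: t_spanZ; exact: t_span_wd.
apply: t_spanZ; rewrite mulr_suml; apply: t_span_sum => e eX.
by rewrite -mulrA; apply: t_span_dwd => //; exact: (subsetP (Xset_subH Fb i)).
Qed.

Lemma t_span_Md d u : d \in diagH n Fb -> t_span u -> t_span (t_d d * u).
Proof.
move=> dH [c ->]; rewrite mulr_sumr; apply: t_span_sum => _ /WHP[w [e [eH ->]]].
rewrite -scalerAr; apply: t_spanZ; rewrite t_wd ?perm_gl_in //.
exact: t_span_dwd.
Qed.

Lemma t_span1 : t_span 1.
Proof.
have <- : t_ n Fb (perm_gl F (1 : 'S_N) * 1)%g = 1.
  rewrite t_wd ?perm_gl_in ?group1 // t_d1 mulr1.
  have /reduced_exprE[_] := some_reduced_exprP (perm_gl_in F (1 : 'S_N)%g).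
  by rewrite inversions1 /Defs.t_w => /size0nil ->; rewrite big_nil.
by apply/t_span_t/WHP; exists 1%g, 1%g; rewrite group1.
Qed.

Lemma t_spanning u : t_span u.
Proof.
elim/pres_alg_ind: u => [|u v|c u||[i|d] u].
- exact: t_span0.
- exact: t_spanD.
- exact: t_spanZ.
- exact: t_span1.
- exact: t_span_Ms.
- rewrite -[d]sgvalK => su; apply: t_span_Md => //; exact: subgP.
Qed.

End Spanning.

Theorem theorem3p2 (F : finFieldType) (q n a b : nat) (Fb : {group {unit F}}) :
  #|F| = q -> (1 <= n)%N -> (0 < a)%N -> (0 < b)%N -> coprime a b ->
  (a * b)%N = (q - 1)%N -> #|Fb| = b ->
  is_basis_on (V := hecke n Fb : lmodType baseA) (WH n Fb) (t_ n Fb).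
Proof.
by move=> _ _ _ _ _ _ _; split; [exact: t_spanning | exact: t_independent].
Qed.
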